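(* A reversible continuous-time Markov chain on a finite set $V$ is determined by its Donsker–Varadhan rate functional: if $R$ and $R'$ are jump rates on $V$ of two reversible continuous-time Markov chains, with generators $\mathscr L,\mathscr L'$ and Donsker–Varadhan rate functionals $\mathscr I,\mathscr I':\mathscr P(V)\to[0,+\infty]$, and $\mathscr I(\mu)=\mathscr I'(\mu)$ for all $\mu\in\mathscr P(V)$, then $R(x,y)=R'(x,y)$ for all $x\ne y\in V$, that is, $\mathscr L=\mathscr L'$.
   Context: Jump rates on $V$ are numbers $R(x,y)\ge 0$, $x\neq y\in V$; the generator is $(\mathscr Lf)(x)=\sum_{y}R(x,y)[f(y)-f(x)]$. The chain need not be irreducible. It is reversible if there is a probability measure $\pi$ on $V$ with $\pi(x)>0$ for all $x\in V$ and $\pi(x)R(x,y)=\pi(y)R(y,x)$ for all $x\neq y$. $\mathscr P(V)$ is the set of probability measures on $V$. The Donsker–Varadhan rate functional is $\mathscr I(\mu)=\sup_{u:V\to(0,\infty)}\ -\sum_{x\in V}\mu(x)\frac{(\mathscr Lu)(x)}{u(x)}$. *)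

(* Defs.v *)
From mathcomp Require Import all_boot all_order all_algebra.
From mathcomp Require Import all_classical all_reals ereal.
Set Implicit Arguments.
Unset Strict Implicit.
Unset Printing Implicit Defensive.
Import Order.TTheory GRing.Theory Num.Theory.
Local Open Scope classical_set_scope.
Local Open Scope ring_scope.

(* Rates are total functions [r : V -> V -> R]; no definition below reads the
   diagonal values [r x x], so only the rates at [x != y] matter. *)
Definition jump_rates (R : realType) (V : finType) (r : V -> V -> R) : Prop :=
  forall x y, x != y -> 0 <= r x y.

Definition generator (R : realType) (V : finType) (r : V -> V -> R)
    (f : V -> R) : V -> R :=
  fun x => \sum_(y | y != x) r x y * (f y - f x).

(* A probability measure on the finite set [V] is given by its point masses. *)
Definition prob_measure (R : realType) (V : finType) (mu : V -> R) : Prop :=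
  (forall x, 0 <= mu x) /\ \sum_x mu x = 1.

Definition reversible (R : realType) (V : finType) (r : V -> V -> R) : Prop :=
  exists pi : V -> R,
    [/\ prob_measure pi,
        forall x, 0 < pi x
      & forall x y, x != y -> pi x * r x y = pi y * r y x].

Definition DV_rate (R : realType) (V : finType) (r : V -> V -> R)
    (mu : V -> R) : \bar R :=
  ereal_sup [set (- \sum_x mu x * (generator r u x / u x))%:E
            | u in [set u : V -> R | forall x, 0 < u x]].

(* Main.v *)
Require Import Defs.
From mathcomp Require Import all_boot all_order all_algebra.
From mathcomp Require Import all_classical all_reals ereal.
From mathcomp Require Import ring.
Import Order.TTheory GRing.Theory Num.Theory.
Local Open Scope ring_scope.

(** At [mu = pi f^2], with [pi] reversible and [f > 0], the supremum defining
    the rate functional is attained at [u = f] and equals half the Dirichlet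
    energy [\sum_(x, y) pi x r x y (f y - f x)^2].  Taking [mu = pi], the rate
    functional of [r] vanishes, hence so does that of [r'], which forces
    detailed balance of [r'] with respect to [pi] as well.  Then both Dirichlet
    energies, taken with the same [pi], agree on all positive functions, and
    polarization recovers their conductances [pi x r x y]. *)

Definition dirichlet {R : realType} {V : finType} (c : V -> V -> R)
    (f : V -> R) : R :=
  \sum_x \sum_y c x y * (f y - f x) ^+ 2.

Definition detailed_balance {R : realType} {V : finType} (pi : V -> R)
    (r : V -> V -> R) : Prop :=
  forall x y, pi x * r x y = pi y * r y x.

Lemma generatorE (R : realType) (V : finType) (r : V -> V -> R) (f : V -> R) x :
  generator r f x = \sum_y r x y * (f y - f x).
Proof. by rewrite [RHS](bigD1 x) //= subrr mulr0 add0r. Qed.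

(** The double sum equals its average with its transpose, and detailed balance gives both halves the
    same conductance [pi x * r x y]. The result can then be bounded pair by pair. *)
Lemma DV_functional_symmetrized (R : realType) (V : finType)
    (pi : V -> R) (r : V -> V -> R) (f u : V -> R) :
  detailed_balance pi r -> (forall x, 0 < u x) ->
  - \sum_x pi x * f x ^+ 2 * (generator r u x / u x) =
  2^-1 * \sum_x \sum_y pi x * r x y *
    (f x ^+ 2 + f y ^+ 2 - f x ^+ 2 * u y / u x - f y ^+ 2 * u x / u y).
Proof.
move=> db u0.
pose g x y := pi x * r x y * (f x ^+ 2 - f x ^+ 2 * u y / u x).
have -> : - \sum_x pi x * f x ^+ 2 * (generator r u x / u x) =
    \sum_x \sum_y g x y.
  rewrite -sumrN; apply: eq_bigr => x _.
  rewrite generatorE mulr_suml mulr_sumr -sumrN; apply: eq_bigr => y _.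
  by rewrite /g; field; rewrite gt_eqF.
transitivity (2^-1 * (\sum_x \sum_y g x y + \sum_x \sum_y g y x)).
  by rewrite [X in _ + X]exchange_big /=; field.
congr (_ * _); rewrite -big_split; apply: eq_bigr => x _.
rewrite -big_split; apply: eq_bigr => y _ /=.
by rewrite /g (db y x); ring.
Qed.

(** The gap is the square [(a * t - b * s) ^+ 2 / (s * t)]. It vanishes when [(s, t)] is
    proportional to [(a, b)], which is why [u = f] is optimal. *)
Lemma le_sqr_weighted (R : realFieldType) (a b s t : R) : 0 < s -> 0 < t ->
  a ^+ 2 + b ^+ 2 - a ^+ 2 * t / s - b ^+ 2 * s / t <= (b - a) ^+ 2.
Proof.
move=> s0 t0; rewrite -subr_ge0.
suff -> : (b - a) ^+ 2 -
    (a ^+ 2 + b ^+ 2 - a ^+ 2 * t / s - b ^+ 2 * s / t) =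
    (a * t - b * s) ^+ 2 / (s * t).
  by rewrite divr_ge0 ?sqr_ge0// mulr_ge0// ltW.
by field; rewrite !gt_eqF.
Qed.

Lemma DV_rate_reversible (R : realType) (V : finType)
    (pi : V -> R) (r : V -> V -> R) (f : V -> R) :
  jump_rates r -> (forall x, 0 < pi x) -> detailed_balance pi r ->
  (forall x, 0 < f x) ->
  DV_rate r (fun x => pi x * f x ^+ 2) =
    (2^-1 * dirichlet (fun x y => pi x * r x y) f)%:E.
Proof.
move=> r0 pi0 db f0; apply/eqP; rewrite eq_le; apply/andP; split.
  apply: ge_ereal_sup => _ [u u0 <-]; rewrite lee_fin.
  rewrite (DV_functional_symmetrized _ _ _ _ _ _ db u0).
  rewrite ler_pM2l ?invr_gt0//; apply: ler_sum => x _; apply: ler_sum => y _.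
  (* [r x x] may be negative, so the diagonal terms must be shown equal, not merely ordered. *)
  have [<-|xy] := eqVneq x y.
    have -> : f x ^+ 2 + f x ^+ 2 - f x ^+ 2 * u x / u x - f x ^+ 2 * u x / u x
        = (f x - f x) ^+ 2 by field; rewrite gt_eqF.
    exact: lexx.
  apply: ler_wpM2l; first by rewrite mulr_ge0 ?r0// ltW.
  exact: le_sqr_weighted.
apply: ereal_sup_ubound; exists f => //.
rewrite (DV_functional_symmetrized _ _ _ _ _ _ db f0); congr (_ * _)%:E.
apply: eq_bigr => x _; apply: eq_bigr => y _.
by field; rewrite !gt_eqF.
Qed.

(** With [f] the square root of [mu / pi], the energy of [f] is zero. Hence across each pair either
    the conductance vanishes or [f] takes equal values; in both cases detailed balance passes from
    [pi] to [mu]. *)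
Lemma detailed_balance_of_DV_rate0 (R : realType) (V : finType)
    (pi mu : V -> R) (r : V -> V -> R) :
  jump_rates r -> (forall x, 0 < pi x) -> detailed_balance pi r ->
  (forall x, 0 < mu x) -> DV_rate r mu = 0%:E -> detailed_balance mu r.
Proof.
move=> r0 pi0 db mu0 I0 x y.
have [<- //|xy] := eqVneq x y.
pose f x := Num.sqrt (mu x / pi x).
have f0 z : 0 < f z by rewrite sqrtr_gt0 divr_gt0.
have muE z : mu z = pi z * f z ^+ 2.
  by rewrite sqr_sqrtr ?divr_ge0 ?ltW//; field; rewrite gt_eqF.
have t0 z w : 0 <= pi z * r z w * (f w - f z) ^+ 2.
  have [<-|zw] := eqVneq z w; first by rewrite subrr expr0n mulr0.
  by rewrite mulr_ge0 ?sqr_ge0// mulr_ge0 ?r0// ltW.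
have : dirichlet (fun x y => pi x * r x y) f = 0.
  move: I0; have -> : mu = fun z => pi z * f z ^+ 2 by exact/funext.
  rewrite (DV_rate_reversible _ _ _ _ _ r0 pi0 db f0) => -[] /eqP.
  by rewrite mulf_eq0 invr_eq0 pnatr_eq0 /= => /eqP.
move/psumr_eq0P => /(_ (fun z _ => sumr_ge0 _ (fun w _ => t0 z w)) x isT).
move/psumr_eq0P => /(_ (fun w _ => t0 x w) y isT) /eqP.
rewrite mulf_eq0 sqrf_eq0 subr_eq0 => cf.
rewrite !muE (mulrAC (pi x)) (mulrAC (pi y)) (db y x).
by case/orP: cf => [/eqP ->|/eqP ->]; rewrite ?mul0r.
Qed.

Lemma dirichletZ (R : realType) (V : finType) (c : V -> V -> R) (f : V -> R) k :
  dirichlet c (fun x => k * f x) = k ^+ 2 * dirichlet c f.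
Proof.
rewrite /dirichlet mulr_sumr; apply: eq_bigr => x _.
rewrite mulr_sumr; apply: eq_bigr => y _; ring.
Qed.

Lemma sum_delta2 (R : realType) (V : finType) (c : V -> V -> R) a b :
  \sum_x \sum_y c x y * ((x == a)%:R * (y == b)%:R) = c a b.
Proof.
rewrite (bigD1 a)//= (bigD1 b)//= !eqxx !mulr1 !big1 ?addr0//.
  by move=> x /negPf xa; rewrite big1// => y _; rewrite xa mul0r mulr0.
by move=> y /negPf ->; rewrite !mulr0.
Qed.

(* The constant [1] does not change the energy; it only keeps the test
   functions positive. *)
Lemma dirichlet_polarization (R : realType) (V : finType) (c : V -> V -> R)
    (a b : V) : a != b ->
  dirichlet c (fun x => 1 + (x == a)%:R) +
  dirichlet c (fun x => 1 + (x == b)%:R) -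
  dirichlet c (fun x => 1 + (x == a)%:R + (x == b)%:R) =
  2 * (c a b + c b a).
Proof.
move=> ab; rewrite -[in RHS](sum_delta2 _ _ c a b) -(sum_delta2 _ _ c b a).
rewrite -sumrN -!big_split mulr_sumr; apply: eq_bigr => x _ /=.
rewrite -sumrN -!big_split mulr_sumr; apply: eq_bigr => y _ /=.
have disj z : (z == a)%:R * (z == b)%:R = 0 :> R.
  have [->|_] := eqVneq z a; last by rewrite mul0r.
  by rewrite (negPf ab) mulr0.
have := disj x; have := disj y; move: (x == a)%:R (x == b)%:R.
move: (y == a)%:R (y == b)%:R (c x y) => ya yb k xa xb hy hx.
(* This is [-2 * k * (ya - xa) * (yb - xb)], the cross term of the square; its products at a single
   point vanish by [disj]. *)
transitivity (2 * k * (xa * yb + xb * ya - ya * yb - xa * xb)); first by ring.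
by rewrite hx hy !subr0; ring.
Qed.

Lemma dirichlet_inj_sym (R : realType) (V : finType) (c c' : V -> V -> R) :
  (forall x y, c x y = c y x) -> (forall x y, c' x y = c' y x) ->
  (forall f : V -> R, (forall x, 0 < f x) -> dirichlet c f = dirichlet c' f) ->
  forall x y, x != y -> c x y = c' x y.
Proof.
move=> sc sc' cc' a b ab.
have pos (z x : V) : 0 < 1 + (x == z)%:R :> R by rewrite ltr_pwDl ?ler0n.
have := dirichlet_polarization _ _ c a b ab.
rewrite (cc' _ (pos a)) (cc' _ (pos b)) cc' => [|x]; last first.
  by rewrite ltr_wpDr ?pos ?ler0n.
rewrite dirichlet_polarization// -(sc a) -(sc' a) -!mulr2n => /mulfI.
rewrite pnatr_eq0 => /(_ isT) /eqP; rewrite eqrMn2r /= => /eqP.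
exact: esym.
Qed.

Lemma reversible_detailed_balance (R : realType) (V : finType)
    (r : V -> V -> R) : reversible r ->
  exists pi : V -> R,
    [/\ prob_measure pi, forall x, 0 < pi x & detailed_balance pi r].
Proof.
move=> [pi [ppi pi0 db]]; exists pi; split=> // x y.
by have [<- //|] := eqVneq x y; exact: db.
Qed.

(** The rate functionals are compared only on probability measures, so a test function must be
    rescaled. The factor [k] later cancels because the energy is homogeneous of degree 2. *)
Lemma prob_measure_sqr_normalized (R : realType) (V : finType)
    (pi f : V -> R) : prob_measure pi ->
  (forall x, 0 < pi x) -> (forall x, 0 < f x) ->
  exists2 k : R, 0 < k & prob_measure (fun x => pi x * (k * f x) ^+ 2).
Proof.
move=> [_ pi1] pi0 f0; pose m := \sum_x pi x * f x ^+ 2.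
have t0 x : 0 < pi x * f x ^+ 2 by rewrite mulr_gt0 ?exprn_gt0.
have m0 : 0 < m.
  (* An empty [V] is excluded by the total mass 1 of [pi]. *)
  have [x _|V0] := pickP (@predT V).
    rewrite /m (bigD1 x)//= ltr_pwDl ?t0// sumr_ge0// => y _; exact: ltW (t0 y).
  by move/eqP: pi1; rewrite big_pred0// eq_sym oner_eq0.
exists (Num.sqrt m^-1); first by rewrite sqrtr_gt0 invr_gt0.
split=> [x|]; first by rewrite mulr_ge0 ?sqr_ge0 ?ltW.
rewrite (eq_bigr (fun x => m^-1 * (pi x * f x ^+ 2))) => [|x _].
  by rewrite -mulr_sumr mulVf// gt_eqF.
by rewrite exprMn sqr_sqrtr ?invr_ge0 ?ltW//; ring.
Qed.

Theorem corollary5p3 (R : realType) (V : finType) (r r' : V -> V -> R)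
    (hr : jump_rates r) (hr' : jump_rates r')
    (hrev : reversible r) (hrev' : reversible r')
    (hI : forall mu : V -> R, prob_measure mu -> DV_rate r mu = DV_rate r' mu) :
  (forall x y : V, x != y -> r x y = r' x y) /\ generator r = generator r'.
Proof.
suff rE x y : x != y -> r x y = r' x y.
  split=> //; apply/funext => f; apply/funext => x.
  by apply: eq_bigr => y yx; rewrite rE// eq_sym.
have [pi [ppi pi0 db]] := reversible_detailed_balance _ _ _ hrev.
have [pi' [_ pi'0 db']] := reversible_detailed_balance _ _ _ hrev'.
have dbr : detailed_balance pi r'.
  apply: (detailed_balance_of_DV_rate0 _ _ _ _ _ hr' pi'0 db' pi0).
  (* Writing [pi] with the constant test function 1 makes its energy for [r] zero. *)
  rewrite -hI//; have -> : pi = fun z => pi z * 1 ^+ 2.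
    by apply/funext => z; rewrite expr1n mulr1.
  rewrite (DV_rate_reversible _ _ _ _ (fun=> 1) hr pi0 db)//; congr _%:E.
  rewrite /dirichlet big1 ?mulr0// => z _; rewrite big1// => w _.
  by rewrite subrr expr0n mulr0.
(* Multiplying by [pi x] turns rates into conductances, symmetric for both chains by [db] and
   [dbr]. *)
move=> xy; apply: (mulfI (lt0r_neq0 (pi0 x))); move: x y xy.
apply: dirichlet_inj_sym => // f f0.
have [k k0 pm] := prob_measure_sqr_normalized _ _ _ _ ppi pi0 f0.
have kf0 x : 0 < k * f x by rewrite mulr_gt0.
have := hI _ pm; rewrite !(DV_rate_reversible _ _ pi _ (fun x => k * f x))//.
rewrite !dirichletZ => -[] /mulfI; rewrite invr_eq0 pnatr_eq0 => /(_ isT).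
by move/mulfI; apply; rewrite sqrf_eq0 gt_eqF.
Qed.
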